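(* There exist numbers $\lambda_0>1$ and $C>0$, depending only on $\xi$, $d$ and $h$, such that for all $\lambda\ge\lambda_0$ and all $u\in H_0^{2,h}(\Omega_h)$ the following Carleman estimate holds: $$B_h(u,\lambda)\ge C\sum_{j,s}h^2\int_{-\xi}^{d}|u_{zz}(x_j,y_s,z)|^2\varphi_\lambda(z)\,dz+C\lambda\sum_{j,s}h^2\int_{-\xi}^{d}|u_z(x_j,y_s,z)|^2\varphi_\lambda(z)\,dz+C\lambda^3\sum_{j,s}h^2\int_{-\xi}^{d}|u(x_j,y_s,z)|^2\varphi_\lambda(z)\,dz,$$ where $$B_h(u,\lambda)=\sum_{j,s}h^2\int_{-\xi}^{d}|\Delta^h u(x_j,y_s,z)|^2\varphi_\lambda(z)\,dz .$$
   Context: Let $b,\xi,d>0$, $\Omega=\{(x,y,z):|x|<b,|y|<b,\,-\xi<z<d\}$, and $\Gamma=\{(x,y,z):|x|<b,|y|<b,\,z=-\xi\}$. Fix a grid step $h>0$ and a uniform grid $\{(x_j,y_s)\}_{j,s=1}^{N_h}\subset[-b,b]^2$ with step $h$. Set $\Omega_h=\{(x_j,y_s,z):1\le j,s\le N_h,\ z\in(-\xi,d)\}$. A semidiscrete function is a family $\{f(x_j,y_s,z)\}_{j,s=1}^{N_h}$ of functions of $z\in(-\xi,d)$. Complex valued functions are identified with pairs of real valued functions (real and imaginary parts). A grid point $(x_j,y_s)$ is interior if $|x_j|<b,|y_s|<b$; at interior grid points define $u^h_{xx}(x_j,y_s,z)=\big(u(x_j-h,y_s,z)-2u(x_j,y_s,z)+u(x_j+h,y_s,z)\big)/h^2$,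 analogously $u^h_{yy}$, and $\Delta^h u=u_{zz}+u^h_{xx}+u^h_{yy}$. Difference operators are evaluated only at interior grid points, and sums $\sum_{j,s}$ run over the grid points at which the summand is defined. The space $H^{2,h}(\Omega_h)$ consists of semidiscrete complex valued functions with finite norm $\|f\|^2_{H^{2,h}(\Omega_h)}=\sum_{j,s=1}^{N_h}\sum_{r=0}^{2}h^2\int_{-\xi}^{d}|\partial_z^r f(x_j,y_s,z)|^2dz$. The subspace $H_0^{2,h}(\Omega_h)$ consists of $f\in H^{2,h}(\Omega_h)$ with $f|_{\partial\Omega}=0$ and $f_z|_\Gamma=0$, meaning: $f(x_j,y_s,z)=0$ for all $z$ whenever $(x_j,y_s)$ lies on the boundary of $[-b,b]^2$, $f(x_j,y_s,-\xi)=f(x_j,y_s,d)=0$ and $f_z(x_j,y_s,-\xi)=0$ for all $j,s$. The Carleman weight function is $\varphi_\lambda(z)=e^{-2\lambda z}$. *)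

(* Defs.v *)
From mathcomp Require Import all_boot all_order all_algebra.
From mathcomp Require Import all_classical all_reals all_analysis.
Set Implicit Arguments. Unset Strict Implicit. Unset Printing Implicit Defensive.
Import Order.TTheory GRing.Theory Num.Theory.
Local Open Scope classical_set_scope.
Local Open Scope ring_scope.

(* A semidiscrete real-valued function: (j, s, z) |-> f(x_j, y_s, z).
   A complex-valued semidiscrete function is a pair (real part, imag part). *)
Definition sdfun (R : realType) := nat -> nat -> R -> R.

Section Defs.
Variable R : realType.
Local Notation mu := (@lebesgue_measure R).

(* One-dimensional H^2(a,c): f is (the absolutely continuous representative
   of) an H^2 function with first derivative f1 and second weak derivative
   f2, i.e. f2 in L^2(a,c), f1(z) = f1(a) + int_a^z f2, f(z) = f(a) + int_a^z f1. *)
Definition H2_1d (a c : R) (f f1 f2 : R -> R) : Prop :=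
  [/\ measurable_fun `[a, c] f2,
      (\int[mu]_(z in `[a, c]) ((f2 z) ^+ 2)%:E < +oo)%E,
      (forall z, a <= z <= c -> f1 z = f1 a + Rintegral mu `[a, z] f2)
    & (forall z, a <= z <= c -> f z = f a + Rintegral mu `[a, z] f1)].

Definition H20h (xi d : R) (N : nat)
  (ur ui ur1 ui1 ur2 ui2 : sdfun R) : Prop :=
  [/\ (forall j s, (1 <= j <= N)%N -> (1 <= s <= N)%N ->
         H2_1d (- xi) d (ur j s) (ur1 j s) (ur2 j s) /\
         H2_1d (- xi) d (ui j s) (ui1 j s) (ui2 j s)),
      (forall j s z, (1 <= j <= N)%N -> (1 <= s <= N)%N ->
         [|| j == 1%N, j == N, s == 1%N | s == N] -> - xi <= z <= d ->
         ur j s z = 0 /\ ui j s z = 0),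
      (forall j s, (1 <= j <= N)%N -> (1 <= s <= N)%N ->
         [/\ ur j s (- xi) = 0, ui j s (- xi) = 0, ur j s d = 0 & ui j s d = 0])
    & (forall j s, (1 <= j <= N)%N -> (1 <= s <= N)%N ->
         ur1 j s (- xi) = 0 /\ ui1 j s (- xi) = 0)].

(* Semidiscrete Laplacian at an interior grid point (j, s), for one real
   component v with second z-derivative v2. *)
Definition lap_h (h : R) (v v2 : sdfun R) (j s : nat) (z : R) : R :=
  v2 j s z
  + (v j.-1 s z - 2 * v j s z + v j.+1 s z) / h ^+ 2
  + (v j s.-1 z - 2 * v j s z + v j s.+1 z) / h ^+ 2.

Definition phi_lam (lam z : R) : R := expR (- 2 * lam * z).

Definition wsum (xi d h lam : R) (lo hi : nat) (F : nat -> nat -> R -> R) : \bar R :=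
  (\sum_(lo <= j < hi.+1) \sum_(lo <= s < hi.+1)
     (h ^+ 2)%:E * \int[mu]_(z in `[(- xi)%R, d]) (F j s z * phi_lam lam z)%:E)%E.

Definition B_h (xi d h lam : R) (N : nat) (ur ui ur2 ui2 : sdfun R) : \bar R :=
  wsum xi d h lam 2 N.-1
    (fun j s z => (lap_h h ur ur2 j s z) ^+ 2 + (lap_h h ui ui2 j s z) ^+ 2).

End Defs.

(* Main.v *)
(* Since u(-xi) = u_z(-xi) = 0, both u and u_z are integrals from -xi, and the
   decreasing weight gives the one-dimensional Hardy inequality
     lam^2 int g^2 e^{-2 lam z} <= int f^2 e^{-2 lam z},  g(z) = int_{-xi}^z f,
   by a weighted Cauchy-Schwarz inequality and Tonelli. Applied twice, it bounds
   lam^2 |u_z|^2 and lam^4 |u|^2 by |u_zz|^2, at each grid point separately. For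
   fixed h the difference quotients are bounded operators, so they are absorbed
   by the lam^4 term as soon as lam^4 >= 256 / h^4. At lateral boundary points
   u vanishes identically in z, hence u_zz = 0 almost everywhere there. *)
Require Import Defs.
From mathcomp Require Import all_boot all_order all_algebra.
From mathcomp Require Import all_classical all_reals all_analysis.
From mathcomp Require Import measurable_realfun zify ring lra.
Set Implicit Arguments. Unset Strict Implicit. Unset Printing Implicit Defensive.
Import Order.TTheory GRing.Theory Num.Theory.
Import numFieldNormedType.Exports.
Local Open Scope classical_set_scope.
Local Open Scope ring_scope.

(** * Integrability of linear combinations of real functions *)

Section IntegrableEFin.
Context d (T : measurableType d) (R : realType) (mu : {measure set T -> \bar R}).
Variables (D : set T) (mD : measurable D).
Implicit Types f g : T -> R.

Lemma integrableZ_EFin k f :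
  mu.-integrable D (EFin \o f) -> mu.-integrable D (EFin \o (fun x => k * f x)).
Proof. by move=> fi; exact: (integrableZl mD k fi). Qed.

Lemma integrableD_EFin f g :
  mu.-integrable D (EFin \o f) -> mu.-integrable D (EFin \o g) ->
  mu.-integrable D (EFin \o (fun x => f x + g x)).
Proof. by move=> fi gi; exact: (integrableD mD fi gi). Qed.

End IntegrableEFin.

(** * Exponential weights and the weighted Hardy inequality *)

Section Hardy.
Context {R : realType}.
Local Notation mu := (@lebesgue_measure R).
Implicit Types (a c k lam x y z t : R) (f g : R -> R).

Lemma derivable_expRZ k x : derivable (fun t => expR (k * t)) x 1.
Proof. exact: ex_derive. Qed.

Lemma continuous_expRZ k : continuous (fun t : R => expR (k * t)).
Proof.
by move=> x; apply/differentiable_continuous/derivable1_diffP/derivable_expRZ.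
Qed.

Lemma measurable_expRZ k (D : set R) : measurable_fun D (fun t : R => expR (k * t)).
Proof.
apply: measurable_funTS; apply: continuous_measurable_fun; exact: continuous_expRZ.
Qed.

Lemma integral_expRZ k x y : k != 0 -> x <= y ->
  (\int[mu]_(t in `[x, y]) (expR (k * t))%:E =
   ((expR (k * y) - expR (k * x)) / k)%:E)%E.
Proof.
move=> k0; rewrite le_eqVlt => /predU1P[<-|xy].
  by rewrite set_itv1 integral_set1 subrr mul0r.
rewrite (@continuous_FTC2 _ _ (fun t => expR (k * t) / k))//.
- by rewrite -EFinB mulrBl.
- exact/continuous_subspaceT/continuous_expRZ.
- split.
  + by move=> t _; exact: ex_derive.
  + by apply: cvgM; [apply: cvg_at_right_filter; exact: continuous_expRZ|exact: cvg_cst].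
  + by apply: cvgM; [apply: cvg_at_left_filter; exact: continuous_expRZ|exact: cvg_cst].
- move=> t _; rewrite derive1E derive_val.
  by rewrite /GRing.scale /=; field.
Qed.

(** Measurability of [f] is a separate clause because measurability of its square does not imply
    it. *)
Definition sq_integrable a c f :=
  measurable_fun `[a, c] f /\
  mu.-integrable `[a, c] (EFin \o (fun z => f z ^+ 2)).

(** On the bounded interval the exponential weight is at most e^{|k| (|a| + |c|)}, so a constant
    multiple of f^2 dominates. *)
Lemma sq_integrable_weight a c k f : sq_integrable a c f ->
  mu.-integrable `[a, c] (EFin \o (fun z => f z ^+ 2 * expR (k * z))).
Proof.
move=> [mf if2].
have mw : measurable_fun `[a, c] (fun z => f z ^+ 2 * expR (k * z)).
  by apply: measurable_funM; [exact: measurable_funX|exact: measurable_expRZ].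
pose M := expR (`|k| * (`|a| + `|c|)).
have iM : mu.-integrable `[a, c] (fun z => M%:E * (f z ^+ 2)%:E)%E.
  exact: integrableZl.
apply: le_integrable iM => //=; first exact/measurable_EFinP.
move=> z; rewrite in_itv/= => /andP[az zc].
rewrite lee_fin normrM (ger0_norm (sqr_ge0 _)) (ger0_norm (expR_ge0 _)).
rewrite normrM (ger0_norm (sqr_ge0 _)) (ger0_norm (expR_ge0 _)) mulrC.
rewrite ler_wpM2r ?sqr_ge0// ler_expR (le_trans (ler_norm _))// normrM.
rewrite ler_wpM2l//.
have := ler_norm c; have := ler_norm (- a); rewrite normrN.
have := normr_ge0 a; have := normr_ge0 c.
case: (ger0P z); lra.
Qed.

(** The interval has finite measure and |f| <= f^2 + 1, which follows from (|f| - 1)^2 >= 0. *)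
Lemma sq_integrable_integrable a c f : sq_integrable a c f ->
  mu.-integrable `[a, c] (EFin \o f).
Proof.
move=> [mf if2].
have i1 : mu.-integrable `[a, c] (EFin \o (fun=> 1 : R)).
  apply: continuous_compact_integrable; first exact: segment_compact.
  by apply: continuous_subspaceT => x; exact: cvg_cst.
have iD : mu.-integrable `[a, c] (fun z => (f z ^+ 2)%:E + 1%:E)%E.
  exact: integrableD.
apply: le_integrable iD => //=; first exact/measurable_EFinP.
move=> z _; rewrite lee_fin (ger0_norm (_ : 0 <= f z ^+ 2 + 1)); last first.
  by rewrite addr_ge0 ?sqr_ge0.
have := sqr_ge0 (`|f z| - 1); rewrite sqrrB real_normK ?num_real//.
have := normr_ge0 (f z); rewrite mulr1 -mulr_natl expr1n; nra.
Qed.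

(* With w the integral of f and E = e^{lam z} / lam, integrate
   2 w f <= E f^2 e^{- lam t} + (w^2 / E) e^{lam t}. *)
Lemma sq_Rintegral_le a c lam z f : 0 < lam -> sq_integrable a c f ->
  a <= z <= c ->
  (\int[mu]_(t in `[a, z]) f t) ^+ 2 <=
  expR (lam * z) / lam * \int[mu]_(t in `[a, z]) (f t ^+ 2 * expR (- lam * t)).
Proof.
move=> l0 sf /andP[az zc].
set w := \int[mu]_(t in _) f t.
set E := expR (lam * z) / lam.
have E0 : 0 < E by rewrite divr_gt0 ?expR_gt0.
have sub : `[a, z] `<=` `[a, c] by apply: subset_itvl; rewrite bnd_simp.
have i1 : mu.-integrable `[a, z] (EFin \o f).
  by apply: integrableS (sq_integrable_integrable sf).
have i2 : mu.-integrable `[a, z] (EFin \o (fun t => f t ^+ 2 * expR (- lam * t))).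
  by apply: integrableS (sq_integrable_weight _ sf).
have i3 : mu.-integrable `[a, z] (EFin \o (fun t => expR (lam * t))).
  apply: continuous_compact_integrable; first exact: segment_compact.
  exact/continuous_subspaceT/continuous_expRZ.
have H : \int[mu]_(t in `[a, z]) (2 * w * f t) <=
    \int[mu]_(t in `[a, z]) (E * (f t ^+ 2 * expR (- lam * t)) +
                             w ^+ 2 / E * expR (lam * t)).
  apply: le_Rintegral => //=.
  - exact: integrableZ_EFin.
  - by apply: integrableD_EFin => //; exact: integrableZ_EFin.
  move=> t _; rewrite mulNr expRN.
  have p0 : 0 < expR (lam * t) by exact: expR_gt0.
  rewrite -subr_ge0; set p := expR _ in p0 *.
  have -> : E * (f t ^+ 2 * p^-1) + w ^+ 2 / E * p - 2 * w * f t =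
    (E * f t - w * p) ^+ 2 / (E * p).
    by field; rewrite (gt_eqF E0) (gt_eqF p0).
  by apply: divr_ge0; [exact: sqr_ge0 | exact/ltW/mulr_gt0].
move: H; rewrite RintegralD//; [|exact: integrableZ_EFin..].
rewrite !RintegralZl// -/w [\int[mu]_(t in _) expR _]/Rintegral.
rewrite integral_expRZ ?gt_eqF//=.
set A := \int[mu]_(_ in _) _ => H.
(* The integral of e^{lam t} over [a, z] is at most e^{lam z} / lam = E, so the second term is at
   most w^2. What remains is 2 w^2 <= E A + w^2. *)
have : w ^+ 2 / E * ((expR (lam * z) - expR (lam * a)) / lam) <= w ^+ 2.
  rewrite mulrAC ler_pdivrMr// ler_wpM2l ?sqr_ge0// ler_pM2r ?invr_gt0//.
  by rewrite lerBlDr lerDl expR_ge0.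
nra.
Qed.

(** The pointwise bound on g^2 turns the left integral into a double integral over t <= z. After
    exchanging the order, the inner integral of e^{- lam z} over [t, c] is at most e^{- lam t} /
    lam. Each of the two steps yields a factor 1 / lam, hence the constant 1 after multiplication by
    lam^2. *)
Lemma weighted_hardy a c lam f g : 0 < lam -> sq_integrable a c f ->
  measurable_fun `[a, c] g ->
  (forall z, a <= z <= c -> g z = \int[mu]_(t in `[a, z]) f t) ->
  ((lam ^+ 2)%:E * \int[mu]_(z in `[a, c]) (g z ^+ 2 * expR (- (2 * lam) * z))%:E <=
  \int[mu]_(z in `[a, c]) (f z ^+ 2 * expR (- (2 * lam) * z))%:E)%E.
Proof.
move=> l0 sf mg gE.
pose T := measurableTypeR R.
(* Both factors are extended by zero and the constraint t <= z becomes an indicator, so that Tonelli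
   applies to one nonnegative function on the whole plane. *)
pose p : T -> R := (fun t => f t ^+ 2 * expR (- lam * t)) \_ `[a, c].
pose q : T -> R := (fun z => expR (- lam * z)) \_ `[a, c].
pose F (zt : T * T) := (q zt.1 * p zt.2 * \1_[set zt : T * T | zt.2 <= zt.1] zt)%:E.
have pE t : p t = if a <= t <= c then f t ^+ 2 * expR (- lam * t) else 0.
  by rewrite /p patchE mem_setE in_itv.
have qE z : q z = if a <= z <= c then expR (- lam * z) else 0.
  by rewrite /q patchE mem_setE in_itv.
have FE z t : F (z, t) = (q z * p t * (t <= z)%R%:R)%:E.
  by rewrite /F/= indicE; congr (_ * (nat_of_bool _)%:R)%:E; apply/idP/idP; rewrite inE.
have q0 z : 0 <= q z by rewrite qE; case: ifP => // _; exact: expR_ge0.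
have p0 z : 0 <= p z.
  by rewrite pE; case: ifP => // _; rewrite mulr_ge0 ?sqr_ge0 ?expR_ge0.
have mp : measurable_fun setT p.
  apply/(measurable_restrictT _ _).1 => //; apply: measurable_funM.
    by apply: measurable_funX; case: sf.
  exact: measurable_expRZ.
have mq : measurable_fun setT q.
  by apply/(measurable_restrictT _ _).1 => //; exact: measurable_expRZ.
have mF : measurable_fun setT F.
  apply/measurable_EFinP; apply: measurable_funM; first apply: measurable_funM.
  - exact: measurableT_comp.
  - exact: measurableT_comp.
  - apply: measurable_indic; rewrite -[X in measurable X]setTI.
    exact: measurable_fun_le.
have F0 zt : (0 <= F zt)%E by rewrite lee_fin !mulr_ge0.
have tonelli := @fubini_tonelli _ _ _ _ R mu mu F mF F0.
have mFz : measurable_fun setT (fun z : T => \int[mu]_t F (z, t))%E.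
  exact: (@measurable_fun_fubini_tonelli_F _ _ _ _ R mu F mF F0).
have mFt : measurable_fun setT (fun t : T => \int[mu]_z F (z, t))%E.
  exact: (@measurable_fun_fubini_tonelli_G _ _ _ _ R mu F mF F0).
have mw k (h : R -> R) : measurable_fun `[a, c] h ->
    measurable_fun `[a, c] (fun t => (h t ^+ 2 * expR (k * t))%:E).
  move=> mh; apply/measurable_EFinP/measurable_funM; first exact: measurable_funX.
  exact: measurable_expRZ.
have lV0 : 0 <= lam^-1 by rewrite invr_ge0 ltW.
(* The factor e^{lam z} / lam of the pointwise bound uses up half of the weight e^{-2 lam z}; the
   other half is the e^{- lam z} carried by [q]. *)
have Hz z : z \in `[a, c] ->
    ((g z ^+ 2 * expR (- (2 * lam) * z))%:E <= lam^-1%:E * \int[mu]_t F (z, t))%E.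
  rewrite in_itv/= => zac; have /andP[az zc] := zac.
  have -> : (\int[mu]_t F (z, t) = (expR (- lam * z) *
      \int[mu]_(t in `[a, z]) (f t ^+ 2 * expR (- lam * t)))%:E)%E.
    have iz : mu.-integrable `[a, z] (EFin \o (fun t => f t ^+ 2 * expR (- lam * t))).
      apply: integrableS (sq_integrable_weight _ sf) => //.
      by apply: subset_itvl; rewrite bnd_simp.
    rewrite -RintegralZl// /Rintegral fineK; last first.
      exact/integrable_fin_num/integrableZ_EFin.
    rewrite [RHS]integral_mkcond; apply: eq_integral => t _.
    rewrite FE pE qE patchE/= mem_setE in_itv/= zac.
    case: (leP t z) => tz; last by rewrite andbF mulr0.
    by rewrite (le_trans tz zc) !andbT; case: ifP; rewrite ?mulr0 ?mul0r ?mulr1.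
  rewrite -EFinM lee_fin (gE z zac).
  apply: (le_trans (ler_wpM2r (expR_ge0 _) (sq_Rintegral_le l0 sf zac))).
  set A := \int[mu]_(t in _) _.
  rewrite (_ : - (2 * lam) * z = - lam * z + - lam * z); last by ring.
  rewrite expRD mulNr expRN le_eqVlt; apply/predU1P; left; field.
  by rewrite !gt_eqF ?expR_gt0.
(* Inner integral in z after the exchange: the contribution - e^{- lam c} / lam of the upper
   endpoint is dropped, and e^{- lam t} completes the weight to e^{-2 lam t}. *)
have Ht t : (\int[mu]_z F (z, t) <= lam^-1%:E *
    ((fun t => (f t ^+ 2 * expR (- (2 * lam) * t))%:E) \_ `[a, c]) t)%E.
  rewrite [X in (_ <= _ * X)%E]patchE mem_setE in_itv/=.
  case: ifPn => tac; last first.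
    rewrite integral0_eq ?mule0// => z _.
    by rewrite FE pE (negbTE tac) mulr0 mul0r.
  have /andP[at_ tc] := tac.
  have -> : (\int[mu]_z F (z, t) =
      \int[mu]_(z in `[t, c]) ((p t)%:E * (expR (- lam * z))%:E))%E.
    rewrite [RHS]integral_mkcond; apply: eq_integral => z _.
    rewrite FE qE patchE/= mem_setE in_itv/=.
    case: (leP t z) => tz; last by rewrite mulr0.
    by rewrite (le_trans at_ tz) /=; case: ifP; rewrite ?mul0r// mulr1 mulrC.
  rewrite ge0_integralZl_EFin//; last first.
    apply/measurable_EFinP; exact (@measurable_expRZ (- lam) _).
  rewrite integral_expRZ ?oppr_eq0 ?gt_eqF// -!EFinM lee_fin.
  rewrite pE tac.
  rewrite (_ : - (2 * lam) * t = - lam * t + - lam * t); last by ring.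
  rewrite expRD; set et := expR (_ * t); set ec := expR (_ * c).
  rewrite [leRHS](_ : _ = f t ^+ 2 * et * (et / lam)); last by ring.
  rewrite (ler_wpM2l (mulr_ge0 (sqr_ge0 _) (expR_ge0 _)))//.
  by rewrite invrN mulrN -mulNr opprB ler_wpM2r// gerBl expR_ge0.
(* Since F is nonnegative, the outer integral may be enlarged from [a, c] to the whole line. *)
have le1 : (\int[mu]_(z in `[a, c]) (g z ^+ 2 * expR (- (2 * lam) * z))%:E <=
    lam^-1%:E * \int[mu]_z \int[mu]_t F (z, t))%E.
  rewrite -ge0_integralZl_EFin//; last by move=> z _; exact: integral_ge0.
  apply: (@le_trans _ _ (\int[mu]_(z in `[a, c]) (lam^-1%:E * \int[mu]_t F (z, t)))%E).
    apply: ge0_le_integral => //.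
    - by move=> z _; rewrite lee_fin mulr_ge0 ?sqr_ge0 ?expR_ge0.
    - exact: mw.
    - by apply: measurable_funTS; exact: measurable_funeM.
  apply: ge0_subset_integral => //.
  - exact: measurable_funeM.
  - by move=> z _; rewrite mule_ge0 ?lee_fin// integral_ge0.
have le2 : (\int[mu]_z \int[mu]_t F (z, t) <= lam^-1%:E *
    \int[mu]_(z in `[a, c]) (f z ^+ 2 * expR (- (2 * lam) * z))%:E)%E.
  rewrite [X in (_ <= _ * X)%E]integral_mkcond tonelli -ge0_integralZl_EFin//.
  - apply: ge0_le_integral => //.
    + by move=> t _; exact: integral_ge0.
    + apply: measurable_funeM; apply/(measurable_restrictT _ _).1 => //.
      by apply: mw; case: sf.
  - by move=> t _; apply: erestrict_ge0 => z _; rewrite lee_fin mulr_ge0 ?sqr_ge0 ?expR_ge0.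
  - apply/(measurable_restrictT _ _).1 => //; by apply: mw; case: sf.
have l20 : (0 <= (lam ^+ 2)%:E)%E by rewrite lee_fin sqr_ge0.
apply: (le_trans (lee_wpmul2l l20 le1)).
have lV0e : (0 <= lam^-1%:E)%E by rewrite lee_fin.
apply: (le_trans (lee_wpmul2l l20 (lee_wpmul2l lV0e le2))).
rewrite !muleA -!EFinM (_ : _ * lam^-1 = 1) ?mul1e//.
by field; rewrite gt_eqF.
Qed.
End Hardy.

(** * Weighted square norms, and functions whose primitive vanishes *)

Section WeightedNorm.
Context {R : realType}.
Local Notation mu := (@lebesgue_measure R).
Variables a c : R.
Implicit Types (k lam x y z t : R) (f g : R -> R).

Lemma continuous_sq_integrable f :
  {within `[a, c], continuous f} -> sq_integrable a c f.
Proof.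
move=> cf; split; first exact: subspace_continuous_measurable_fun.
apply: continuous_compact_integrable; first exact: segment_compact.
by move=> x; apply: continuousM; exact: cf.
Qed.

(** Domination by (f + g)^2 <= 2 f^2 + 2 g^2. *)
Lemma sq_integrableD f g : sq_integrable a c f -> sq_integrable a c g ->
  sq_integrable a c (fun z => f z + g z).
Proof.
move=> [mf if2] [mg ig2]; have mfg := measurable_funD mf mg; split=> //.
have i2 : mu.-integrable `[a, c] (EFin \o (fun z => 2 * f z ^+ 2 + 2 * g z ^+ 2)).
  by apply: integrableD_EFin => //; exact: integrableZ_EFin.
apply: le_integrable i2 => //=.
  by apply/measurable_EFinP; exact: (measurable_funX 2 mfg).
move=> z _; rewrite lee_fin ger0_norm ?sqr_ge0// ger0_norm.
  by have := sqr_ge0 (f z - g z); nra.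
by rewrite addr_ge0// mulr_ge0 ?sqr_ge0.
Qed.

Lemma sq_integrableZ k f : sq_integrable a c f ->
  sq_integrable a c (fun z => k * f z).
Proof.
move=> [mf if2]; split; first exact: measurable_funM.
have -> : EFin \o (fun z => (k * f z) ^+ 2) =
          EFin \o (fun z => k ^+ 2 * f z ^+ 2).
  by apply/funext => z /=; rewrite exprMn.
exact: integrableZ_EFin.
Qed.

(** The squared norm of [f] in the weighted L^2 space, as a real number. It stands for the extended
    integral when that is finite, which [EFin_wnorm2] ensures for square integrable [f]. *)
Definition wnorm2 lam f := \int[mu]_(z in `[a, c]) (f z ^+ 2 * phi_lam lam z).

Lemma phi_lamE lam z : phi_lam lam z = expR (- (2 * lam) * z).
Proof. by rewrite /phi_lam mulNr. Qed.

Lemma integrable_wnorm2 lam f : sq_integrable a c f ->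
  mu.-integrable `[a, c] (EFin \o (fun z => f z ^+ 2 * phi_lam lam z)).
Proof.
under [X in EFin \o X]eq_fun do rewrite phi_lamE.
exact: sq_integrable_weight.
Qed.

Lemma EFin_wnorm2 lam f : sq_integrable a c f ->
  (\int[mu]_(z in `[a, c]) (f z ^+ 2 * phi_lam lam z)%:E = (wnorm2 lam f)%:E)%E.
Proof.
by move=> sf; rewrite /wnorm2 /Rintegral fineK//; exact/integrable_fin_num/integrable_wnorm2.
Qed.

Lemma wnorm2_ge0 lam f : 0 <= wnorm2 lam f.
Proof. by apply: Rintegral_ge0 => z _; rewrite mulr_ge0 ?sqr_ge0 ?expR_ge0. Qed.

Lemma integral_wnorm2D lam f g : sq_integrable a c f -> sq_integrable a c g ->
  (\int[mu]_(z in `[a, c]) ((f z ^+ 2 + g z ^+ 2) * phi_lam lam z)%:E =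
   (wnorm2 lam f + wnorm2 lam g)%:E)%E.
Proof.
move=> sf sg; rewrite EFinD -!EFin_wnorm2// -integralD//; try exact: integrable_wnorm2.
by apply: eq_integral => z _; rewrite mulrDl.
Qed.

Lemma wnorm2_hardy lam f g : 0 < lam -> sq_integrable a c f ->
  sq_integrable a c g ->
  (forall z, a <= z <= c -> g z = \int[mu]_(t in `[a, z]) f t) ->
  lam ^+ 2 * wnorm2 lam g <= wnorm2 lam f.
Proof.
move=> l0 sf sg gE; rewrite -lee_fin EFinM -!EFin_wnorm2//.
under eq_integral do rewrite phi_lamE.
under [leRHS]eq_integral do rewrite phi_lamE.
by apply: weighted_hardy => //; case: sg.
Qed.

Lemma primitive_continuous f g : a < c -> mu.-integrable `[a, c] (EFin \o f) ->
  (forall z, a <= z <= c -> g z = g a + \int[mu]_(t in `[a, z]) f t) ->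
  {within `[a, c], continuous g}.
Proof.
move=> ac fi gE.
apply: (@subspace_eq_continuous _ _ _ (fun z => g a + \int[mu]_(t in `[a, z]) f t)).
  by move=> z /set_mem; rewrite /from_subspace/= in_itv/= => /gE.
move=> z; apply: cvgD; first exact: cvg_cst.
exact: (parameterized_integral_continuous (ltW ac) fi).
Qed.

Lemma derive1_eq0_oo (F : R -> R) x : a < x < c -> (forall z, a < z < c -> F z = 0) ->
  (F^`() x)%classic = 0.
Proof.
move=> /andP[ax xc] F0; rewrite derive1E.
rewrite (@near_eq_derive _ _ _ F (cst 0)) ?derive_cst//.
near=> z; apply: F0; apply/andP; split; near: z; [exact: lt_nbhsr|exact: lt_nbhsl].
Unshelve. all: by end_near. Qed.

(** At an interior point a continuous [f] is the derivative of its primitive, and that primitive is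
    zero in a neighbourhood. *)
Lemma continuous_eq0_primitive f : a < c -> {within `[a, c], continuous f} ->
  (forall z, a < z < c -> \int[mu]_(t in `[a, z]) f t = 0) ->
  forall z, a < z < c -> f z = 0.
Proof.
move=> ac cf F0 z zac; have /andP[az zc] := zac.
have fi : mu.-integrable `[a, c] (EFin \o f).
  by apply: sq_integrable_integrable; exact: continuous_sq_integrable.
have cfz : {for z, continuous f}.
  by apply: (within_continuous_continuous ac cf); rewrite in_itv/= zac.
have [_ <-] := continuous_FTC1_closed zc fi az cfz.
exact: derive1_eq0_oo.
Qed.

(** The analogue for merely integrable [f]: by Lebesgue differentiation the primitive has derivative
    [f] almost everywhere. *)
Lemma ae_eq0_primitive f : a < c -> mu.-integrable `[a, c] (EFin \o f) ->
  (forall z, a < z < c -> \int[mu]_(t in `[a, z]) f t = 0) ->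
  {ae mu, forall z, a < z < c -> f z = 0}.
Proof.
move=> ac fi F0.
(* Extension by zero makes the function integrable on [a, y] for every y, as the differentiation
   theorem requires. *)
pose h := f \_ `[a, c].
have hi y : mu.-integrable `[a, y] (EFin \o h).
  apply: (@integrableS _ _ _ mu setT) => //.
  rewrite /h -restrict_EFin.
  exact: (@integrable_mkcond _ _ _ mu `[a, c] (EFin \o f) (measurable_itv _)).1.

have loch := integrable_locally (measurable_itv `[a, c]) fi.
have := @FTC1 R h (BLeft a) hi loch.
apply: filterS; first exact: (ae_filter_ringOfSetsType mu).
move=> z Hz zac; have /andP[az zc] := zac.
have [|_] := Hz; first exact: az.
rewrite /h patchE mem_setE in_itv/= !ltW//= => <-.
apply: derive1_eq0_oo => // y yac; rewrite -[RHS](F0 y yac).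
apply: eq_Rintegral => t /set_mem; rewrite /= in_itv/= => /andP[ta ty].
rewrite patchE mem_setE in_itv/= ta (le_trans ty)//.
by have /andP[_ /ltW] := yac.
Qed.

Lemma wnorm2_eq0 lam f : sq_integrable a c f ->
  {ae mu, forall z, a < z < c -> f z = 0} -> wnorm2 lam f = 0.
Proof.
move=> sf f0; apply: EFin_inj; rewrite -EFin_wnorm2//.
have mw : measurable_fun `[a, c] (fun z => (f z ^+ 2 * phi_lam lam z)%:E).
  by have := integrable_wnorm2 lam sf => /integrableP[].
(* Vanishing is known only inside the interval, so the endpoints, a null set, are removed first. *)
rewrite integral_itv_bndoo; last by apply: measurable_funS mw => //; exact: subset_itv_oo_cc.
rewrite -[RHS](@integral0 _ _ _ mu [set` `]a, c[]).
apply: ge0_ae_eq_integral => //.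
- by apply: measurable_funS mw => //; exact: subset_itv_oo_cc.
- by move=> z _; rewrite lee_fin mulr_ge0 ?sqr_ge0 ?expR_ge0.
- move: f0; apply: filterS; first exact: (ae_filter_ringOfSetsType mu).
  move=> z f0; rewrite /= in_itv/= => /f0 ->.
  by rewrite expr0n mul0r.
Qed.

End WeightedNorm.

(** * One-dimensional estimates at a single grid point *)

Section H2.
Context {R : realType}.
Local Notation mu := (@lebesgue_measure R).
Variables (a c : R) (f f1 f2 : R -> R).
Hypotheses (ac : a < c) (H2f : H2_1d a c f f1 f2).

(** Regularity climbs from [f2]: it is integrable on a bounded interval, so its primitive [f1] is
    continuous, and then so is [f]. *)
Lemma H2_1d_sq_integrable :
  [/\ sq_integrable a c f, sq_integrable a c f1 & sq_integrable a c f2].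
Proof.
have [mf2 if2 f1E fE] := H2f.
have sf2 : sq_integrable a c f2.
  split=> //; apply/integrableP; split.
    by apply/measurable_EFinP; exact: (measurable_funX 2 mf2).
  apply: le_lt_trans if2; rewrite le_eqVlt; apply/predU1P; left.
  by apply: eq_integral => z _ /=; rewrite ger0_norm ?sqr_ge0.
have sf1 : sq_integrable a c f1.
  apply: continuous_sq_integrable.
  exact: (primitive_continuous ac (sq_integrable_integrable sf2)).
split=> //; apply: continuous_sq_integrable.
exact: (primitive_continuous ac (sq_integrable_integrable sf1)).
Qed.

(** The zero data at [a] make [f1] and [f] exact primitives of [f2] and [f1], so Hardy applies first
    to one pair and then to the other. *)
Lemma H2_1d_carleman lam : 0 < lam -> f a = 0 -> f1 a = 0 ->
  lam ^+ 2 * wnorm2 a c lam f1 <= wnorm2 a c lam f2 /\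
  lam ^+ 4 * wnorm2 a c lam f <= wnorm2 a c lam f2.
Proof.
move=> l0 fa f1a; have [_ _ f1E fE] := H2f.
have [sf sf1 sf2] := H2_1d_sq_integrable.
have h1 : lam ^+ 2 * wnorm2 a c lam f1 <= wnorm2 a c lam f2.
  by apply: wnorm2_hardy => // z /f1E ->; rewrite f1a add0r.
split=> //; apply: le_trans h1; rewrite (exprD _ 2 2) -mulrA.
rewrite ler_wpM2l ?sqr_ge0//.
by apply: wnorm2_hardy => // z /fE ->; rewrite fa add0r.
Qed.

Lemma H2_1d_wnorm2_eq0 lam : f1 a = 0 -> (forall z, a <= z <= c -> f z = 0) ->
  wnorm2 a c lam f2 = 0.
Proof.
move=> f1a f0; have [_ _ f1E fE] := H2f.
have [sf sf1 sf2] := H2_1d_sq_integrable.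
have cf1 := primitive_continuous ac (sq_integrable_integrable sf2) f1E.
have itv z : a < z < c -> a <= z <= c by move=> /andP[/ltW -> /ltW ->].
have f10 : forall z, a < z < c -> f1 z = 0.
  apply: continuous_eq0_primitive => // z /itv zac.
  have fa : f a = 0 by apply: f0; rewrite lexx ltW.
  by have := fE z zac; rewrite (f0 z zac) fa add0r => <-.
apply: wnorm2_eq0 => //; apply: ae_eq0_primitive => //.
  exact: sq_integrable_integrable.
by move=> z zac; have := f1E z (itv z zac); rewrite f10// f1a add0r => <-.
Qed.

End H2.

(** * Recovering u_zz from the semidiscrete Laplacian *)

Section Laplacian.
Context {R : realType}.
Local Notation mu := (@lebesgue_measure R).
Variables (a c h : R) (v v2 : sdfun R) (j s : nat).
Hypotheses (h0 : 0 < h) (s2 : sq_integrable a c (v2 j s))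
  (su : sq_integrable a c (v j s))
  (sl : sq_integrable a c (v j.-1 s)) (sr : sq_integrable a c (v j.+1 s))
  (sd : sq_integrable a c (v j s.-1)) (st : sq_integrable a c (v j s.+1)).

Lemma sq_integrable_lap_h : sq_integrable a c (lap_h h v v2 j s).
Proof.
have -> : lap_h h v v2 j s = fun z => v2 j s z +
   (h ^- 2 * v j.-1 s z + (h ^- 2 * v j.+1 s z +
   (h ^- 2 * v j s.-1 z + (h ^- 2 * v j s.+1 z + (- 4 / h ^+ 2) * v j s z)))).
  by apply/funext => z; rewrite /lap_h; field; rewrite gt_eqF.
by do ?[apply: sq_integrableD|apply: sq_integrableZ].
Qed.

(** With B the five-point sum, v_zz = L - B / h^2, whose square is at most 2 L^2 + 2 B^2 / h^4.
    Together with B^2 <= 8 (...) this gives the constant 16 / h^4. *)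
Lemma wnorm2_lap_h lam : wnorm2 a c lam (v2 j s) <=
  2 * wnorm2 a c lam (lap_h h v v2 j s) + 16 / h ^+ 4 *
  (wnorm2 a c lam (v j.-1 s) + (wnorm2 a c lam (v j.+1 s) +
  (wnorm2 a c lam (v j s.-1) + (wnorm2 a c lam (v j s.+1) +
   4 * wnorm2 a c lam (v j s))))).
Proof.
have i := @integrable_wnorm2 R a c lam.
rewrite /wnorm2 -!(RintegralZl, RintegralD)//;
  do ?[exact/i/sq_integrable_lap_h | exact: i | apply: integrableD_EFin => //
      | apply: integrableZ_EFin => //].
apply: le_Rintegral => //;
  do ?[exact/i/sq_integrable_lap_h | exact: i | apply: integrableD_EFin => //
      | apply: integrableZ_EFin => //].
move=> z _; set p := phi_lam lam z; have p0 : 0 <= p by exact: expR_ge0.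
set L := lap_h h v v2 j s z.
set x1 := v j.-1 s z; set x2 := v j.+1 s z; set x3 := v j s.-1 z.
set x4 := v j s.+1 z; set x5 := v j s z.
pose B := x1 + x2 + x3 + x4 - 4 * x5.
have -> : v2 j s z = L - B / h ^+ 2.
  by rewrite /L /lap_h -/x1 -/x2 -/x3 -/x4 -/x5 /B; field; rewrite gt_eqF.
(* Cauchy-Schwarz for the vectors (1, 1, 1, 1, -2) and (x1, x2, x3, x4, 2 x5); the first has squared
   length 8. The difference is the sum of squares in Lagrange's identity. *)
have B2 : B ^+ 2 <= 8 * (x1 ^+ 2 + (x2 ^+ 2 + (x3 ^+ 2 + (x4 ^+ 2 + 4 * x5 ^+ 2)))).
  rewrite -subr_ge0.
  have -> : 8 * (x1 ^+ 2 + (x2 ^+ 2 + (x3 ^+ 2 + (x4 ^+ 2 + 4 * x5 ^+ 2)))) - B ^+ 2 =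
    (x1 - x2) ^+ 2 + (x1 - x3) ^+ 2 + (x1 - x4) ^+ 2 + (x2 - x3) ^+ 2 +
    (x2 - x4) ^+ 2 + (x3 - x4) ^+ 2 + 4 * ((x1 + x5) ^+ 2 + (x2 + x5) ^+ 2 +
    (x3 + x5) ^+ 2 + (x4 + x5) ^+ 2) by rewrite /B; ring.
  by do ?[exact: sqr_ge0 | apply: addr_ge0 | apply: mulr_ge0].
clearbody L B x1 x2 x3 x4 x5 p.
have sq : (L - B / h ^+ 2) ^+ 2 <= 2 * L ^+ 2 + 2 / h ^+ 4 * B ^+ 2.
  rewrite -subr_ge0.
  have -> : 2 * L ^+ 2 + 2 / h ^+ 4 * B ^+ 2 - (L - B / h ^+ 2) ^+ 2 =
    (L + B / h ^+ 2) ^+ 2 by field; rewrite gt_eqF.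
  exact: sqr_ge0.
have h4 : 0 <= 2 / h ^+ 4 by rewrite divr_ge0// exprn_ge0// ltW.
have := ler_wpM2r p0 (le_trans sq (lerD (lexx _) (ler_wpM2l h4 B2))).
move=> /le_trans; apply; rewrite le_eqVlt; apply/predU1P; left; ring.
Qed.

End Laplacian.

(** * Comparing sums over interior points with sums over the full grid *)

Section GridSums.
Context {R : realType}.
Implicit Types (g : nat -> R) (A : nat -> nat -> R) (m n : nat).

Lemma ler_sum_nat_widen g m m' n n' : (forall i, 0 <= g i) ->
  (m' <= m)%N -> (n <= n')%N ->
  \sum_(m <= i < n) g i <= \sum_(m' <= i < n') g i.
Proof.
move=> g0 mm nn; have [mn|nm] := leqP m n; last first.
  by rewrite big_geq ?(ltnW nm)// sumr_ge0.
rewrite (big_cat_nat (leq_trans mm mn) nn)/= (big_cat_nat mm mn)/=.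
by rewrite -addrA addrCA lerDl addr_ge0 ?sumr_ge0.
Qed.

(** Here [f] and [f'] stand for the identity or a shift by one, so a single argument treats all five
    stencil positions. *)
Lemma ler_sum_inner2 A n (f f' : nat -> nat) : (forall j s, 0 <= A j s) ->
  (forall g, (forall i, 0 <= g i) ->
     \sum_(2 <= i < n.+2) g (f i) <= \sum_(1 <= i < n.+3) g i) ->
  (forall g, (forall i, 0 <= g i) ->
     \sum_(2 <= i < n.+2) g (f' i) <= \sum_(1 <= i < n.+3) g i) ->
  \sum_(2 <= j < n.+2) \sum_(2 <= s < n.+2) A (f j) (f' s) <=
  \sum_(1 <= j < n.+3) \sum_(1 <= s < n.+3) A j s.
Proof.
move=> A0 hf hf'.
apply: (@le_trans _ _ (\sum_(2 <= j < n.+2) \sum_(1 <= s < n.+3) A (f j) s)).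
  by apply: ler_sum => j _; exact: hf'.
by apply: (hf (fun j => \sum_(1 <= s < n.+3) A j s)) => j; exact: sumr_ge0.
Qed.

(** Each shifted copy of the interior stays inside the grid, so each costs at most one full sum; 8 =
    1 + 1 + 1 + 1 + 4. *)
Lemma ler_sum_stencil A n : (forall j s, 0 <= A j s) ->
  \sum_(2 <= j < n.+2) \sum_(2 <= s < n.+2)
    (A j.-1 s + (A j.+1 s + (A j s.-1 + (A j s.+1 + 4 * A j s)))) <=
  8 * \sum_(1 <= j < n.+3) \sum_(1 <= s < n.+3) A j s.
Proof.
move=> A0.
have hid g : (forall i, 0 <= g i) ->
    \sum_(2 <= i < n.+2) g (id i) <= \sum_(1 <= i < n.+3) g i.
  by move=> g0; exact: ler_sum_nat_widen.
have hp g : (forall i, 0 <= g i) ->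
    \sum_(2 <= i < n.+2) g i.-1 <= \sum_(1 <= i < n.+3) g i.
  by move=> g0; rewrite big_add1/=; apply: ler_sum_nat_widen => //; exact: leqW.
have hs g : (forall i, 0 <= g i) ->
    \sum_(2 <= i < n.+2) g i.+1 <= \sum_(1 <= i < n.+3) g i.
  by move=> g0; rewrite -(big_add1 _ _ 2 n.+3 predT); exact: ler_sum_nat_widen.
under eq_bigr do rewrite !big_split/= -mulr_sumr.
rewrite !big_split/= -mulr_sumr.
have := ler_sum_inner2 A0 hp hid; have := ler_sum_inner2 A0 hs hid.
have := ler_sum_inner2 A0 hid hp; have := ler_sum_inner2 A0 hid hs.
by have := ler_sum_inner2 A0 hid hid; rewrite /=; lra.
Qed.

Lemma sum_nat_ends0 g n : g 1%N = 0 -> g n.+2 = 0 ->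
  \sum_(1 <= i < n.+3) g i = \sum_(2 <= i < n.+2) g i.
Proof.
move=> g1 gn; rewrite big_nat_recr//= gn addr0.
by case: n gn => [|n] _; rewrite big_ltn// g1 add0r.
Qed.

End GridSums.

(** * Passage to real sums and proof of the Carleman estimate *)

Lemma wsum_EFin (R : realType) (xi d h lam : R) lo hi F (G : nat -> nat -> R) :
  (forall j s, (lo <= j <= hi)%N -> (lo <= s <= hi)%N ->
   (\int[lebesgue_measure]_(z in `[(- xi)%R, d]) (F j s z * phi_lam lam z)%:E =
    (G j s)%:E)%E) ->
  (wsum xi d h lam lo hi F =
   (h ^+ 2 * \sum_(lo <= j < hi.+1) \sum_(lo <= s < hi.+1) G j s)%:E)%E.
Proof.
move=> FG; rewrite /wsum mulr_sumr -sumEFin; apply: eq_big_nat => j jr.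
rewrite mulr_sumr -sumEFin; apply: eq_big_nat => s sr.
by rewrite FG.
Qed.

Unset Implicit Arguments.

Theorem theorem7p1 (R : realType) (xi d h : R) :
  0 < xi -> 0 < d -> 0 < h ->
  exists lam0 C : R, 1 < lam0 /\ 0 < C /\
  forall (b : R) (N : nat), 0 < b -> (N.-1)%:R * h = 2 * b ->
  forall lam : R, lam0 <= lam ->
  forall ur ui ur1 ui1 ur2 ui2 : sdfun R,
    H20h xi d N ur ui ur1 ui1 ur2 ui2 ->
    (B_h xi d h lam N ur ui ur2 ui2 >=
       C%:E * wsum xi d h lam 1 N (fun j s z => ((ur2 j s z) ^+ 2 + (ui2 j s z) ^+ 2)%R)
     + (C * lam)%:E * wsum xi d h lam 1 N (fun j s z => ((ur1 j s z) ^+ 2 + (ui1 j s z) ^+ 2)%R)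
     + (C * lam ^+ 3)%:E * wsum xi d h lam 1 N (fun j s z => ((ur j s z) ^+ 2 + (ui j s z) ^+ 2)%R))%E.
Proof.
(* This threshold gives lam^4 >= lam >= 256 / h^4, twice the stencil constant 128 / h^4. For C, each
   of the three terms will be at most 4 times the Laplacian sum, hence 12. *)
move=> xi0 d0 h0; exists (2 + 256 / h ^+ 4), (12^-1).
have h4 : 0 < 256 / h ^+ 4 by apply: divr_gt0; [rewrite ltr0n | exact: exprn_gt0].
split; first by lra.
split; first by lra.
move=> b N b0 Nb lam lam_ge ur ui ur1 ui1 ur2 ui2 [H2 bd0 z0 dz0].
(* For N = 0 or N = 1 the truncated predecessor is 0, contradicting 2 b > 0. The interior indices
   then run from 2 to n + 1, an empty range when n = 0. *)
have {b b0 Nb} [n NE] : exists n, N = n.+2.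
  case: N Nb {H2 bd0 z0 dz0} => [|[|n]] /=; [| |by exists n]; rewrite mul0r; lra.
rewrite {}NE in H2 bd0 z0 dz0 *.
have ac : - xi < d by lra.
have l0 : 0 < lam by lra.
(* Adding real and imaginary parts, [A], [E], [D] and [L] are the weighted integrals of |u|^2,
   |u_z|^2, |u_zz|^2 and |Delta^h u|^2 at one grid point. *)
pose W := wnorm2 (- xi) d lam.
pose A j s := W (ur j s) + W (ui j s).
pose E j s := W (ur1 j s) + W (ui1 j s).
pose D j s := W (ur2 j s) + W (ui2 j s).
pose L j s := W (lap_h h ur ur2 j s) + W (lap_h h ui ui2 j s).
have A0 j s : 0 <= A j s by rewrite addr_ge0// wnorm2_ge0.
have sq j s : (1 <= j <= n.+2)%N -> (1 <= s <= n.+2)%N ->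
    [/\ [/\ sq_integrable (- xi) d (ur j s), sq_integrable (- xi) d (ur1 j s)
        & sq_integrable (- xi) d (ur2 j s)] &
        [/\ sq_integrable (- xi) d (ui j s), sq_integrable (- xi) d (ui1 j s)
        & sq_integrable (- xi) d (ui2 j s)]].
  by move=> jN sN; have [Hr Hi] := H2 j s jN sN; split; exact: H2_1d_sq_integrable.
have car j s : (1 <= j <= n.+2)%N -> (1 <= s <= n.+2)%N ->
    lam ^+ 2 * E j s <= D j s /\ lam ^+ 4 * A j s <= D j s.
  move=> jN sN; have [Hr Hi] := H2 j s jN sN.
  have [r0 i0 _ _] := z0 j s jN sN; have [r10 i10] := dz0 j s jN sN.
  have [r1 r2] := H2_1d_carleman ac Hr l0 r0 r10.
  have [i1 i2] := H2_1d_carleman ac Hi l0 i0 i10.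
  by split; rewrite mulrDr; exact: lerD.
have Dbd j s : (1 <= j <= n.+2)%N -> (1 <= s <= n.+2)%N ->
    [|| j == 1%N, j == n.+2, s == 1%N | s == n.+2] -> D j s = 0.
  move=> jN sN js; have [Hr Hi] := H2 j s jN sN; have [r10 i10] := dz0 j s jN sN.
  rewrite /D /W (H2_1d_wnorm2_eq0 ac Hr)//; last first.
    by move=> z zd; have [] := bd0 j s z jN sN js zd.
  rewrite (H2_1d_wnorm2_eq0 ac Hi) ?addr0//.
  by move=> z zd; have [] := bd0 j s z jN sN js zd.
have int j s : (2 <= j <= n.+1)%N -> (2 <= s <= n.+1)%N ->
  [/\ [/\ (1 <= j <= n.+2)%N, (1 <= j.-1 <= n.+2)%N & (1 <= j.+1 <= n.+2)%N] &
      [/\ (1 <= s <= n.+2)%N, (1 <= s.-1 <= n.+2)%N & (1 <= s.+1 <= n.+2)%N]].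
  by clear; move=> /andP[j2 jn] /andP[s2 sn]; split; split; apply/andP; split; lia.
have sqL j s : (2 <= j <= n.+1)%N -> (2 <= s <= n.+1)%N ->
    sq_integrable (- xi) d (lap_h h ur ur2 j s) /\
    sq_integrable (- xi) d (lap_h h ui ui2 j s).
  move=> j2 s2; have [[j1 jp jn] [s1 sp sn]] := int j s j2 s2.
  have [[? _ ?] [? _ ?]] := sq j s j1 s1.
  have [[? _ _] [? _ _]] := sq _ _ jp s1; have [[? _ _] [? _ _]] := sq _ _ jn s1.
  have [[? _ _] [? _ _]] := sq _ _ j1 sp; have [[? _ _] [? _ _]] := sq _ _ j1 sn.
  by split; exact: sq_integrable_lap_h.
have lap j s : (2 <= j <= n.+1)%N -> (2 <= s <= n.+1)%N ->
    D j s <= 2 * L j s + 16 / h ^+ 4 *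
      (A j.-1 s + (A j.+1 s + (A j s.-1 + (A j s.+1 + 4 * A j s)))).
  move=> j2 s2; have [[j1 jp jn] [s1 sp sn]] := int j s j2 s2.
  have [[u _ u2] [v _ v2]] := sq j s j1 s1.
  have [[ul _ _] [vl _ _]] := sq _ _ jp s1; have [[ur_ _ _] [vr _ _]] := sq _ _ jn s1.
  have [[ud _ _] [vd _ _]] := sq _ _ j1 sp; have [[ut _ _] [vt _ _]] := sq _ _ j1 sn.
  apply: (le_trans (lerD (wnorm2_lap_h h0 u2 u ul ur_ ud ut lam)
                         (wnorm2_lap_h h0 v2 v vl vr vd vt lam))).
  by rewrite /L /A /W le_eqVlt; apply/predU1P; left; ring.
rewrite /B_h.
rewrite (@wsum_EFin _ _ _ _ _ _ _ _ D); last first.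
  by move=> j s jr sr; have [[_ _ ?] [_ _ ?]] := sq j s jr sr; exact: integral_wnorm2D.
rewrite (@wsum_EFin _ _ _ _ _ _ _ _ E); last first.
  by move=> j s jr sr; have [[_ ? _] [_ ? _]] := sq j s jr sr; exact: integral_wnorm2D.
rewrite (@wsum_EFin _ _ _ _ _ _ _ _ A); last first.
  by move=> j s jr sr; have [[? _ _] [? _ _]] := sq j s jr sr; exact: integral_wnorm2D.
rewrite (@wsum_EFin _ _ _ _ _ _ _ _ L); last first.
  by move=> j s jr sr; have [? ?] := sqL j s jr sr; exact: integral_wnorm2D.
set SD := \sum_(_ <= j < _) \sum_(_ <= s < _) D j s.
set SE := \sum_(_ <= j < _) \sum_(_ <= s < _) E j s.
set SA := \sum_(_ <= j < _) \sum_(_ <= s < _) A j s.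
set SL := \sum_(_ <= j < _) \sum_(_ <= s < _) L j s.
have SE_le : lam ^+ 2 * SE <= SD.
  rewrite mulr_sumr; apply: ler_sum_nat => j jr.
  by rewrite mulr_sumr; apply: ler_sum_nat => s sr; have [] := car j s jr sr.
have SA_le : lam ^+ 4 * SA <= SD.
  rewrite mulr_sumr; apply: ler_sum_nat => j jr.
  by rewrite mulr_sumr; apply: ler_sum_nat => s sr; have [] := car j s jr sr.
(* The first and last rows and columns contribute nothing to the u_zz sum, so it can be compared
   with the Laplacian sum over interior points. *)
have SDE : SD = \sum_(2 <= j < n.+2) \sum_(2 <= s < n.+2) D j s.
  rewrite /SD sum_nat_ends0; first apply: eq_big_nat => j /andP[j2 jn].
  - have jr : (1 <= j <= n.+2)%N by rewrite (ltnW j2) ltnW.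
    by apply: sum_nat_ends0; apply: Dbd; rewrite ?eqxx ?orbT ?leqnn.
  - by apply: big1_seq => s; rewrite mem_index_iota => /andP[_ sr]; apply: Dbd; rewrite ?eqxx.
  - by apply: big1_seq => s; rewrite mem_index_iota => /andP[_ sr]; apply: Dbd;
      rewrite ?eqxx ?orbT ?leqnn.
have SD_le : SD <= 2 * SL + 128 / h ^+ 4 * SA.
  apply: (@le_trans _ _ (2 * SL + 16 / h ^+ 4 *
    \sum_(2 <= j < n.+2) \sum_(2 <= s < n.+2)
    (A j.-1 s + (A j.+1 s + (A j s.-1 + (A j s.+1 + 4 * A j s)))))); last first.
    rewrite lerD2l (_ : 128 / h ^+ 4 * SA = 16 / h ^+ 4 * (8 * SA)); last by ring.
    apply: ler_wpM2l; last exact: ler_sum_stencil.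
    by rewrite divr_ge0// exprn_ge0// ltW.
  rewrite SDE !mulr_sumr -big_split/=; apply: ler_sum_nat => j jr.
  rewrite !mulr_sumr -big_split/=; apply: ler_sum_nat => s sr.
  exact: lap.
have SA0 : 0 <= SA by do 2!(apply: sumr_ge0 => ? _).
have SE0 : 0 <= SE.
  by do 2!(apply: sumr_ge0 => ? _); rewrite addr_ge0// wnorm2_ge0.
rewrite -!EFinM -!EFinD lee_fin.
have l1 : 1 <= lam by lra.
have e1 : lam * SE <= SD.
  by apply: le_trans SE_le; rewrite ler_wpM2r// ler_eXnr.
have e2 : lam ^+ 3 * SA <= SD.
  by apply: le_trans SA_le; rewrite ler_wpM2r// ler_weXn2l.
(* Absorption: the stencil error 128 / h^4 times [SA] is at most half of [SD], which leaves SD <= 4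
   SL. *)
have e3 : 256 / h ^+ 4 * SA <= SD.
  apply: le_trans SA_le; rewrite ler_wpM2r//.
  by apply: (@le_trans _ _ lam); [lra|rewrite ler_eXnr].
have e4 : SD <= 4 * SL.
  by rewrite (_ : 256 / h ^+ 4 * SA = 2 * (128 / h ^+ 4 * SA)) in e3; [lra|ring].
rewrite (_ : _ + _ = h ^+ 2 * (12^-1 * (SD + lam * SE + lam ^+ 3 * SA))); last by ring.
by rewrite ler_wpM2l ?sqr_ge0//; lra.
Qed.
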